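(* Let $(M,\omega)$ and $(W,\omega_W)$ be symplectic manifolds, and let $\mathcal H$ be the symplectic connection, with curvature $\Theta(X,Y)(f)=\{H_X,H_Y\}\circ f$, on the principal bundle $$\operatorname{Symp}(M,\omega)\to\operatorname{Symp}(M,W)\to\operatorname{Conf}(M,W).$$ If $\dim W>\dim M$, then the connection $\mathcal H$ is fat.
   Context: $\operatorname{Symp}(M,W)$ is the space of symplectic embeddings of $(M,\omega)$ into $(W,\omega_W)$. The group $\operatorname{Symp}(M,\omega)$ of symplectic diffeomorphisms acts freely on it from the right by precomposition, with quotient $\operatorname{Conf}(M,W)$, the space of symplectic configurations of $M$ in $W$. A vector tangent to $\operatorname{Symp}(M,W)$ at $f$ is a section of $f^*(TW)$ that extends to a Hamiltonian vector field in a neighbourhood of $f(M)\subset W$. Horizontal vectors at $f$ for the connection $\mathcal H$ are those sections $X$ extending to the Hamiltonian vector field of a function $H_X:W\to\mathbb R$ that is constant on $f(M)$ (equivalently, $X$ is pointwise $\omega_W$-orthogonal to $f(M)$). The curvature form is $\Theta(X,Y)(f)=\{H_X,H_Y\}\circ f\in C^\infty(M)$ for horizontal $X,Y$ at $f$, where $\{\cdot,\cdot\}$ is the Poisson bracket of $(W,\omega_W)$. The connection $\mathcal H$ is called fat if this $C^\infty(M)$-valued form is nondegenerate on the horizontal subspace at every embedding $f$: for every nonzero horizontal $X$ at $f$ there is a horizontal $Y$ at $f$ with $\{H_X,H_Y\}\circ f\ne0$ as a function on $M$. *)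

(* Defs.v *)
From HB Require Import structures.
From mathcomp Require Import all_boot all_order all_algebra.
From mathcomp Require Import all_classical all_reals.
From mathcomp Require Import topology normedtype derive.

Set Implicit Arguments.
Unset Strict Implicit.
Unset Printing Implicit Defensive.

Import Order.TTheory GRing.Theory Num.Theory.
Import numFieldNormedType.Exports.

Local Open Scope classical_set_scope.
Local Open Scope ring_scope.

(* C^k and C^oo maps on a set U of a normed space.  The definition is only    *)
(* used for open U, so that directional derivatives at the points of U depend *)
(* only on the values of f on U.                                              *)
Fixpoint Ck_on (R : realType) (V V' : normedModType R) (k : nat) (U : set V)
    (f : V -> V') : Prop :=
  (forall x, U x -> {for x, continuous f}) /\
  (if k is k'.+1 then
     forall v, (forall x, U x -> derivable f x v) /\ Ck_on k' U ('D_v f)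
   else True).

Definition smooth_on (R : realType) (V V' : normedModType R) (U : set V)
  (f : V -> V') : Prop := forall k, Ck_on k U f.

(* A chart is a homeomorphism from the open set [chart_dom] onto an open      *)
(* subset of R^n; the values of [chart_map] outside [chart_dom], and those of *)
(* [chart_inv] outside [chart_codom], are irrelevant.                         *)
Record chart (R : realType) (n : nat) (T : topologicalType) := Chart {
  chart_dom : set T ;
  chart_map :> T -> 'rV[R]_n ;
  chart_inv : 'rV[R]_n -> T ;
  chart_dom_open : open chart_dom ;
  chart_codom_open : open (chart_map @` chart_dom) ;
  chart_map_continuous : {within chart_dom, continuous chart_map} ;
  chart_inv_continuous :
    {within chart_map @` chart_dom, continuous chart_inv} ;
  chart_mapK : {in chart_dom, cancel chart_map chart_inv} }.

Definition chart_codom (R : realType) (n : nat) (T : topologicalType)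
  (c : chart R n T) : set 'rV[R]_n := c @` chart_dom c.

(* The smooth structure is the one generated by [atlas].  [chart_at] selects  *)
(* an arbitrary chart of the atlas around each point, which serves to         *)
(* identify the tangent space T_pM with 'rV[R]_n: a row vector v at p stands  *)
(* for the tangent vector with coordinates v in the chart [chart_at p].       *)
Record manifold (R : realType) (n : nat) := Manifold {
  carrier :> topologicalType ;
  manifold_hausdorff : hausdorff_space carrier ;
  manifold_second_countable : @second_countable carrier ;
  atlas : set (chart R n carrier) ;
  chart_at : carrier -> chart R n carrier ;
  chart_at_atlas : forall p, atlas (chart_at p) ;
  chart_at_dom : forall p, chart_dom (chart_at p) p ;
  atlas_compatible : forall c c', atlas c -> atlas c' ->
    smooth_on (c @` (chart_dom c `&` chart_dom c')) (c' \o chart_inv c) }.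
Arguments atlas {R n} m _.

Section SmoothMaps.
Context {R : realType} {m n : nat} {M : manifold R m} {W : manifold R n}.

Definition smooth_map (f : M -> W) : Prop :=
  continuous f /\
  forall c c', atlas M c -> atlas W c' ->
    smooth_on (c @` (chart_dom c `&` f @^-1` chart_dom c'))
              (c' \o f \o chart_inv c).

(* The matrix of df_p : T_pM -> T_(f p)W, acting on row vectors on the right. *)
Definition tangent_map (f : M -> W) (p : M) : 'M[R]_(m, n) :=
  'J (chart_at (f p) \o f \o chart_inv (chart_at p)) (chart_at p p).

Definition smooth_embedding (f : M -> W) : Prop :=
  [/\ smooth_map f,
      injective f,
      (forall p, row_free (tangent_map f p)) &
      (forall U : set M, open U -> exists2 V : set W, open V & f @^-1` V = U)].

End SmoothMaps.

Section SmoothFunctions.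
Context {R : realType} {n : nat} {M : manifold R n}.

Definition smooth_fun_on (U : set M) (H : M -> R) : Prop :=
  forall c, atlas M c ->
    smooth_on (c @` (chart_dom c `&` U)) (H \o chart_inv c).

Definition dfun (H : M -> R) (p : M) : 'rV[R]_n -> R :=
  'd (H \o chart_inv (chart_at p)) (chart_at p p).

(* The Gram matrix, in the coordinates of the chart c at the point of         *)
(* coordinates x, of the field of bilinear forms                              *)
(* (u, v) |-> u *m w p *m v^T on the tangent spaces T_pM.                     *)
Definition form_in_chart (w : M -> 'M[R]_n) (c : chart R n M)
    (x : 'rV[R]_n) : 'M[R]_n :=
  let p := chart_inv c x in
  let J := 'J (chart_at p \o chart_inv c) x in
  J *m w p *m J^T.

Definition closed_form (w : M -> 'M[R]_n) : Prop :=
  forall c, atlas M c -> forall x, chart_codom c x -> forall i j k,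
    'D_(delta_mx 0 i) (fun y => form_in_chart w c y j k) x +
    'D_(delta_mx 0 j) (fun y => form_in_chart w c y k i) x +
    'D_(delta_mx 0 k) (fun y => form_in_chart w c y i j) x = 0.

End SmoothFunctions.

Record symplectic_form (R : realType) (n : nat) (M : manifold R n) :=
  SymplecticForm {
    form_mx :> M -> 'M[R]_n ;
    form_smooth : forall c, atlas M c ->
      smooth_on (chart_codom c) (form_in_chart form_mx c) ;
    form_skew : forall p, (form_mx p)^T = - form_mx p ;
    form_nondegenerate : forall p, form_mx p \in unitmx ;
    form_closed : closed_form form_mx }.

Section Hamiltonian.
Context {R : realType} {n : nat} {W : manifold R n} (w : symplectic_form W).

Definition form (p : W) (u v : 'rV[R]_n) : R := (u *m w p *m v^T) 0 0.

Definition hamiltonian_field (H : W -> R) (p : W) : 'rV[R]_n :=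
  (\row_j dfun H p (delta_mx 0 j)) *m invmx (w p).

Lemma hamiltonian_fieldP (H : W -> R) (p : W) (v : 'rV[R]_n) :
  form p (hamiltonian_field H p) v = dfun H p v.
Proof.
rewrite /form /hamiltonian_field mulmxKV ?form_nondegenerate// mxE.
rewrite [in RHS](row_sum_delta v) /dfun linear_sum; apply: eq_bigr => j _.
by rewrite !mxE linearZ mulrC.
Qed.

Definition poisson (H K : W -> R) (p : W) : R :=
  form p (hamiltonian_field H p) (hamiltonian_field K p).

End Hamiltonian.

(* The space Symp(M, W) of symplectic embeddings.                             *)
Record symp (R : realType) (m n : nat) (M : manifold R m) (W : manifold R n)
    (wM : symplectic_form M) (wW : symplectic_form W) := Symp {
  symp_map :> M -> W ;
  symp_embedding : smooth_embedding symp_map ;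
  symp_pullback : forall p u v,
    form wW (symp_map p) (u *m tangent_map symp_map p)
                         (v *m tangent_map symp_map p) = form wM p u v }.

Section Connection.
Context {R : realType} {m n : nat} {M : manifold R m} {W : manifold R n}.
Context {wM : symplectic_form M} {wW : symplectic_form W}.
Implicit Types (f : symp wM wW) (X Y : M -> 'rV[R]_n).

(* A section X of f^*(TW) is a function assigning to p a vector X p of the    *)
(* tangent space at f p, hence a row vector.                                  *)

Definition symp_tangent f : set (M -> 'rV[R]_n) :=
  [set X | exists U (H : W -> R),
    [/\ open U, range f `<=` U, smooth_fun_on U H &
        forall p, X p = hamiltonian_field wW H (f p)]].

Definition horizontal_potential f X (H : W -> R) : Prop :=
  [/\ smooth_fun_on setT H,
      exists a, forall p, H (f p) = a &
      forall p, X p = hamiltonian_field wW H (f p)].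

Definition symp_connection f : set (M -> 'rV[R]_n) :=
  [set X | exists H, horizontal_potential f X H].

Lemma symp_connection_tangent f : symp_connection f `<=` symp_tangent f.
Proof.
move=> X [H [sH _ XH]]; exists setT, H.
by split=> //; exact: openT.
Qed.

(* An arbitrarily chosen H_X; the curvature does not depend on the choice, by *)
(* [curvatureE].                                                              *)
Definition potential f X : W -> R := get (horizontal_potential f X).

Definition curvature f X Y : M -> R :=
  poisson wW (potential f X) (potential f Y) \o f.

Lemma curvatureE f X Y (HX HY : W -> R) :
  horizontal_potential f X HX -> horizontal_potential f Y HY ->
  curvature f X Y = poisson wW HX HY \o f.
Proof.
move=> hX hY; apply/funext => p; rewrite /curvature /= /poisson.
have [_ _ <-] : horizontal_potential f X (potential f X).
  by apply: getPex; exists HX.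
have [_ _ <-] : horizontal_potential f Y (potential f Y).
  by apply: getPex; exists HY.
by case: hX hY => _ _ <- [_ _ <-].
Qed.

(* Nondegeneracy of a function-valued form Theta on the horizontal subspaces  *)
(* hor f, at every symplectic embedding f.                                    *)
Definition fat (hor : symp wM wW -> set (M -> 'rV[R]_n))
    (Theta : symp wM wW -> (M -> 'rV[R]_n) -> (M -> 'rV[R]_n) -> M -> R) : Prop :=
  forall f X, hor f X -> X <> cst 0 ->
    exists2 Y, hor f Y & Theta f X Y <> cst 0.

End Connection.

(* Main.v *)
From HB Require Import structures.
From mathcomp Require Import all_boot all_order all_algebra.
From mathcomp Require Import all_classical all_reals.
From mathcomp Require Import topology normedtype derive landau sequences.
From mathcomp Require Import exp ring lra.
Require Import Defs.

(* Let X = X_H be horizontal at f with X p <> 0.  Since H is constant on f(M) *)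
(* and f^*w_W = w_M is nondegenerate, X p is not tangent to f(M).  Near f p   *)
(* the submanifold f(M) is a slice, by the inverse function theorem, so some  *)
(* function K supported near f p vanishes on f(M) and has dK(X p) <> 0.  Then *)
(* X_K is horizontal and {H, K}(f p) = - dK(X p) <> 0.                        *)

Set Implicit Arguments.
Unset Strict Implicit.
Unset Printing Implicit Defensive.

Import Order.TTheory GRing.Theory Num.Theory.
Import numFieldNormedType.Exports.

Local Open Scope classical_set_scope.
Local Open Scope ring_scope.

(** * C^k functions *)

(** A horizontal X is, at each p, [wW]-orthogonal to the tangent space of f(M) at [f p], because its
    potential is constant on f(M). As f pulls [wW] back to the nondegenerate form [wM], this
    orthogonal complement meets the tangent space only in 0 ([hamiltonian_not_tangent]). Hence
    wherever X p is nonzero it points out of f(M), and it can be detected by a global smooth K that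
    vanishes on all of f(M) with dK(X p) nonzero ([vanishing_function]). Vanishing on f(M) makes the
    Hamiltonian field of K horizontal, and the curvature of X with it takes the value - dK(X p) at
    p.

    The function K is built in a chart around [f p]. A linear form that kills the tangent space but
    not X p is applied to the displacement of a point from its retraction onto the image of f
    ([slice_function]); the retraction comes from the inverse function theorem ([local_inverse]).
    Since f is a homeomorphism onto its image, no other sheet of f(M) enters a small enough
    neighbourhood. A bump function then makes the support compact, and the product extends by zero
    to W ([smooth_extend_by_zero]).

    The calculus underneath starts from [Ck_on], which speaks of directional derivatives only:
    differentiability is recovered from continuous partial derivatives ([C1_differentiable]), and
    with it the chain rule for C^k maps ([Ck_comp]). *)

Section CkGeneral.
Context {R : realType} {V V' : normedModType R}.
Implicit Types (U : set V) (f g : V -> V').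

Lemma Ck_continuous k U f x : Ck_on k U f -> U x -> {for x, continuous f}.
Proof. by case: k => [|k] [cf _] Ux; exact: cf. Qed.

Lemma CkS k U f : Ck_on k.+1 U f -> Ck_on k U f.
Proof.
elim: k f => [|k IH] f [cf df]; split=> // v.
by have [? ?] := df v; split=> //; exact: IH.
Qed.

Lemma Ck_le j k U f : (j <= k)%N -> Ck_on k U f -> Ck_on j U f.
Proof. by move=> /subnK <-; elim: (k - j)%N => // i IH /CkS. Qed.

Lemma Ck_derivable k U f x v : Ck_on k.+1 U f -> U x -> derivable f x v.
Proof. by move=> [_ /(_ v)[df _]]; exact: df. Qed.

Lemma Ck_derive k U f v : Ck_on k.+1 U f -> Ck_on k U ('D_v f).
Proof. by move=> [_ /(_ v)[]]. Qed.

(** On an open set, equality on U is equality near each point of U, so it passes to directional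
    derivatives. In the inductions on k below, this is how a derivative is traded for its explicit
    formula. *)
Lemma eq_Ck k U f g : open U -> {in U, f =1 g} -> Ck_on k U f -> Ck_on k U g.
Proof.
move=> oU; elim: k f g => [|k IH] f g fg [cf df].
all: have nfg x : U x -> \forall y \near x, f y = g y.
1,3: by move=> Ux; near=> y; apply: fg; rewrite inE; near: y;
  exact: open_nbhs_nbhs.
all: split => [x Ux|//].
1,2: rewrite /prop_for /continuous_at -(nbhs_singleton (nfg x Ux));
  exact: cvg_trans (near_eq_cvg (nfg x Ux)) (cf x Ux).
move=> v; split=> [x Ux|].
  by apply: near_eq_derivable (nfg x Ux) _; exact: (df v).1.
apply: IH (df v).2 => x; rewrite inE => Ux.
by apply: near_eq_derive; exact: nfg.
Unshelve. all: by end_near. Qed.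

Lemma subset_Ck k U U' f : U `<=` U' -> Ck_on k U' f -> Ck_on k U f.
Proof.
move=> UU'; elim: k f => [|k IH] f [cf df].
all: split=> [x /UU'|//]; try exact: cf.
by move=> v; split=> [x /UU'|]; [exact: (df v).1|exact: IH (df v).2].
Qed.

Lemma Ck_local k U f :
  (forall x, U x -> exists2 B, B x & Ck_on k B f) -> Ck_on k U f.
Proof.
elim: k f => [|k IH] f loc.
all: split=> [x /loc [B Bx]|//].
1,2: by move=> Cf; exact: Ck_continuous Cf Bx.
move=> v; split=> [x /loc [B Bx [_ df]]|]; first exact: (df v).1.
by apply: IH => x /loc [B Bx [_ df]]; exists B => //; exact: (df v).2.
Qed.

Lemma Ck_cst k U (c : V') : open U -> Ck_on k U (cst c).
Proof.
move=> oU; elim: k c => [|k IH] c; split => [x _|//]; try exact: cst_continuous.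
move=> v; split => [x _|]; first exact: derivable_cst.
by apply: eq_Ck (IH 0) => // x _; rewrite derive_cst.
Qed.

Lemma CkD k U f g : open U ->
  Ck_on k U f -> Ck_on k U g -> Ck_on k U (fun x => f x + g x).
Proof.
move=> oU; elim: k f g => [|k IH] f g [cf df] [cg dg].
all: split => [x Ux|//]; try by apply: continuousD; [exact: cf|exact: cg].
move=> v; have [dfv Cf] := df v; have [dgv Cg] := dg v.
split => [x Ux|]; first by apply: derivableD; [exact: dfv|exact: dgv].
apply: eq_Ck (IH _ _ Cf Cg) => // x; rewrite inE => Ux.
by rewrite deriveD //; [exact: dfv|exact: dgv].
Qed.

Lemma Ck_sum k U (I : Type) (r : seq I) (P : pred I) (F : I -> V -> V') :
  open U -> (forall i, P i -> Ck_on k U (F i)) ->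
  Ck_on k U (fun x => \sum_(i <- r | P i) F i x).
Proof.
move=> oU CF; elim: r => [|i r IH].
  by apply: eq_Ck (Ck_cst k 0 oU) => // x _; rewrite big_nil.
case: (boolP (P i)) => Pi; last first.
  by apply: eq_Ck IH => // x _; rewrite big_cons (negbTE Pi).
by apply: eq_Ck (CkD oU (CF _ Pi) IH) => // x _; rewrite big_cons Pi.
Qed.

End CkGeneral.

(** * Algebra of scalar C^k functions *)

Section CkScalar.
Context {R : realType} {V : normedModType R}.
Implicit Types (U : set V) (f g : V -> R).

Lemma CkM k U f g : open U ->
  Ck_on k U f -> Ck_on k U g -> Ck_on k U (fun x => f x * g x).
Proof.
move=> oU; elim: k f g => [|k IH] f g Cf Cg.
all: split => [x Ux|//].
1,2: by apply: continuousM; [exact: Ck_continuous Cf Ux|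
  exact: Ck_continuous Cg Ux].
move=> v; split => [x Ux|].
  by apply: derivableM; [exact: Ck_derivable Cf Ux|exact: Ck_derivable Cg Ux].
have CfDg := IH _ _ (CkS Cf) (Ck_derive v Cg).
have CgDf := IH _ _ (CkS Cg) (Ck_derive v Cf).
apply: eq_Ck (CkD oU CfDg CgDf) => // x; rewrite inE => Ux.
by rewrite deriveM //; [exact: Ck_derivable Cf Ux|exact: Ck_derivable Cg Ux].
Qed.

Lemma CkN k U f : open U -> Ck_on k U f -> Ck_on k U (fun x => - f x).
Proof.
move=> oU Cf; apply: eq_Ck (CkM oU (Ck_cst k (-1 : R) oU) Cf) => // x _.
by rewrite mulN1r.
Qed.

Lemma CkB k U f g : open U ->
  Ck_on k U f -> Ck_on k U g -> Ck_on k U (fun x => f x - g x).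
Proof. by move=> oU Cf Cg; apply: CkD => //; exact: CkN. Qed.

Lemma Ck_prod k U (I : Type) (r : seq I) (P : pred I) (F : I -> V -> R) :
  open U -> (forall i, P i -> Ck_on k U (F i)) ->
  Ck_on k U (fun x => \prod_(i <- r | P i) F i x).
Proof.
move=> oU CF; elim: r => [|i r IH].
  by apply: eq_Ck (Ck_cst k (1 : R) oU) => // x _; rewrite big_nil.
case: (boolP (P i)) => Pi; last first.
  by apply: eq_Ck IH => // x _; rewrite big_cons (negbTE Pi).
by apply: eq_Ck (CkM oU (CF _ Pi) IH) => // x _; rewrite big_cons Pi.
Qed.

Lemma CkV k U f : open U -> (forall x, U x -> f x != 0) ->
  Ck_on k U f -> Ck_on k U (fun x => (f x)^-1).
Proof.
move=> oU f0; elim: k => [|k IH] Cf.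
all: split => [x Ux|//].
1,2: by apply: continuousV; [exact: f0|exact: Ck_continuous Cf Ux].
move=> v; split=> [x Ux|].
  by apply: derivableV; [exact: f0|exact: Ck_derivable Cf Ux].
have Ci := IH (CkS Cf).
apply: eq_Ck (CkM oU (CkN oU (CkM oU Ci Ci)) (Ck_derive v Cf)) => // x.
rewrite inE => Ux; rewrite deriveV ?f0//; last exact: Ck_derivable Cf Ux.
by rewrite expr2 invfM.
Qed.

End CkScalar.

(** * Matrix-valued C^k maps, entry by entry *)

Section CkMatrix.
Context {R : realType} {V : normedModType R} {m n : nat}.
Implicit Types (U : set V) (F : V -> 'M[R]_(m, n)).

Lemma continuous_mxP F x :
  {for x, continuous F} <-> forall i j, {for x, continuous (fun y => F y i j)}.
Proof.
split=> [cF i j|cF].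
  exact: (continuous_comp cF (@coord_continuous _ _ _ i j (F x))).
apply/cvgrPdist_le => e e0.
near=> y.
rewrite /Num.Def.normr/= mx_normrE (bigmax_le _ (ltW e0))//= => i _.
rewrite !mxE/=.
move: i; near: y; apply: filter_forall => /= i.
exact: ((cvgrPdist_le _ _).1 (cF i.1 i.2)).
Unshelve. all: by end_near. Qed.

Lemma Ck_mxP k U F : open U ->
  Ck_on k U F <-> forall i j, Ck_on k U (fun x => F x i j).
Proof.
move=> oU; elim: k F => [|k IH] F.
  split=> [[cF _] i j|CF]; split=> // x Ux.
    by have /continuous_mxP := cF _ Ux; exact.
  by apply/continuous_mxP => i j; exact: Ck_continuous (CF i j) Ux.
have Dij v (x : V) i j : (forall y, U y -> derivable F y v) -> U x ->
    'D_v F x i j = 'D_v (fun y => F y i j) x.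
  by move=> dF Ux; rewrite derive_mx ?mxE//; exact: dF.
split=> [CF i j|CF].
  split=> [x Ux|v]; first by have /continuous_mxP := Ck_continuous CF Ux; exact.
  split=> [x Ux|].
    by apply: (derivable_mxP _ _ _).1; exact: Ck_derivable CF Ux.
  have := (IH _).1 (Ck_derive v CF) i j; apply: eq_Ck => // x.
  by rewrite inE => Ux; apply: (Dij v x) => // y; exact: Ck_derivable CF.
split=> [x Ux|v].
  by apply/continuous_mxP => i j; exact: Ck_continuous (CF i j) Ux.
have dF x : U x -> derivable F x v.
  by move=> Ux; apply/derivable_mxP => i j; exact: Ck_derivable (CF i j) Ux.
split=> //; apply/IH => i j.
apply: eq_Ck (Ck_derive v (CF i j)) => // x; rewrite inE => Ux.
by rewrite Dij.
Qed.

End CkMatrix.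

(** * Directional derivatives and differentiability *)

Section RowNorm.
Context {R : realType} {n : nat}.
Implicit Types u : 'rV[R]_n.

Lemma row_coord_le u i : `|u 0 i| <= `|u|.
Proof.
rewrite [leRHS]/Num.Def.normr/= mx_normrE.
exact: (le_bigmax _ (fun ij => `|u ij.1 ij.2|) (0, i)).
Qed.

Lemma row_norm_le u C : 0 <= C -> (forall i, `|u 0 i| <= C) -> `|u| <= C.
Proof.
move=> C0 uC; rewrite [leLHS]/Num.Def.normr/= mx_normrE bigmax_le// => -[i j] _.
by rewrite /= ord1.
Qed.

Lemma row_norm_lt u C : 0 < C -> (forall i, `|u 0 i| < C) -> `|u| < C.
Proof.
move=> C0 uC; rewrite [ltLHS]/Num.Def.normr/= mx_normrE.
by apply/bigmax_ltP; split=> // -[i j] _ /=; rewrite ord1.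
Qed.

End RowNorm.

Lemma is_derive_line (R : realType) (V W : normedModType R) (f : V -> W)
    (z v : V) (s : R) : derivable f (s *: v + z) v ->
  is_derive s 1 (fun t : R => f (t *: v + z)) ('D_v f (s *: v + z)).
Proof.
move=> df.
pose l (t : R) := f (t *: v + z).
have E : (fun h : R => h^-1 *: ((l \o shift s) (h *: 1) - l s)) = (fun h : R =>
    h^-1 *: ((f \o shift (s *: v + z)) (h *: v) - f (s *: v + z))).
  by apply/funext => h; rewrite /l /= [_%:A]mulr1 scalerDl addrA.
by split; [rewrite /derivable E|rewrite /derive E].
Qed.

(** * Mean value estimates on sup-norm balls *)

Section Box.
Context {R : realType} {n : nat}.
Variables (f : 'rV[R]_n -> R) (c : 'rV[R]_n) (r C : R).
Hypothesis f_der : forall y i, `|y - c| < r -> derivable f y (delta_mx 0 i).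
Hypothesis f_bnd : forall y i, `|y - c| < r -> `|'D_(delta_mx 0 i) f y| <= C.

Lemma edge_lipschitz (z : 'rV[R]_n) i (a b : R) : a <= b ->
  (forall s, a <= s <= b -> `|s *: delta_mx 0 i + z - c| < r) ->
  `|f (b *: delta_mx 0 i + z) - f (a *: delta_mx 0 i + z)| <= C * (b - a).
Proof.
move=> ab inb; have dl s : a <= s <= b ->
    is_derive s 1 (fun t : R => f (t *: delta_mx 0 i + z))
      ('D_(delta_mx 0 i) f (s *: delta_mx 0 i + z)).
  by move=> /inb sb; apply: is_derive_line; exact: f_der.
have [| |s sab ->] := @MVT_segment R (fun t : R => f (t *: delta_mx 0 i + z))
  (fun s => 'D_(delta_mx 0 i) f (s *: delta_mx 0 i + z)) a b ab.
- by move=> s; rewrite in_itv /= => /andP[? ?]; apply: dl; rewrite !ltW.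
- apply: derivable_within_continuous => s; rewrite in_itv /= => sab.
  by have [] := dl _ sab.
rewrite normrM [X in _ * X]ger0_norm ?subr_ge0// ler_wpM2r ?subr_ge0//.
by apply: f_bnd; apply: inb; rewrite in_itv in sab.
Qed.

(** The point x is moved to y one coordinate at a time. A ball of the sup norm is a box, so every
    edge of this path stays inside it, and each of the n edges costs at most C times the norm of y -
    x by the one-variable mean value theorem. *)
Lemma box_lipschitz x y : `|x - c| < r -> `|y - c| < r ->
  `|f y - f x| <= n%:R * C * `|y - x|.
Proof.
move=> xr yr; have r0 : 0 < r by exact: le_lt_trans xr.
pose p k : 'rV[R]_n := \row_j (if (j < k)%N then y 0 j else x 0 j).
have p0 : p 0 = x by apply/rowP => j; rewrite mxE.
have pn : p n = y by apply/rowP => j; rewrite mxE ltn_ord.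
rewrite -p0 -pn -(telescope_sumr (f \o p) (leq0n n)) big_mkord /= p0 pn.
apply: (le_trans (ler_norm_sum _ _ _)).
have -> : n%:R * C * `|y - x| = \sum_(i < n) C * `|y - x|.
  by rewrite sumr_const card_ord -mulrA mulr_natl.
apply: ler_sum => i _.
(* The part common to [p i] and [p i.+1], which differ only in coordinate i. *)
pose z : 'rV[R]_n := \row_j (if j == i then 0 else p i 0 j).
have pE (k : nat) s : (k = i \/ k = i.+1) ->
    s = (if (i < k)%N then y 0 i else x 0 i) -> p k = s *: delta_mx 0 i + z.
  move=> ki ->; apply/rowP => j; rewrite !mxE eqxx /=.
  have [->|ji] := eqVneq j i; first by rewrite mulr1 addr0.
  rewrite mulr0 add0r; case: ki => ->//.
  by rewrite ltnS leq_eqVlt (inj_eq val_inj) (negbTE ji).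
rewrite (pE i (x 0 i)) ?ltnn//; last by left.
rewrite (pE i.+1 (y 0 i)) ?ltnSn//; last by right.
have C0 : 0 <= C by apply: le_trans (f_bnd i xr).
have inbox s : Num.min (x 0 i) (y 0 i) <= s <= Num.max (x 0 i) (y 0 i) ->
    `|s *: delta_mx 0 i + z - c| < r.
  move=> sxy; apply: row_norm_lt => // j; rewrite !mxE eqxx /=.
  have xj := le_lt_trans (row_coord_le (x - c) j) xr.
  have yj := le_lt_trans (row_coord_le (y - c) j) yr.
  rewrite !mxE in xj yj; have [ji|ji] := eqVneq j i; last first.
    by rewrite mulr0 add0r; case: ifP.
  subst j; rewrite mulr1 addr0; move: sxy xj yj; rewrite !ltr_norml.
  by case: (leP (x 0 i) (y 0 i)) => _ /andP[? ?] /andP[? ?] /andP[? ?]; lra.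
have yx : `|y 0 i - x 0 i| <= `|y - x|.
  by have := row_coord_le (y - x) i; rewrite !mxE.
apply: le_trans (ler_wpM2l C0 yx).
have [xy|/ltW yx'] := leP (x 0 i) (y 0 i).
  rewrite [X in _ <= _ * X]ger0_norm ?subr_ge0//.
  apply: edge_lipschitz => // s sxy.
  by apply: inbox; rewrite min_l ?max_r.
rewrite distrC [X in _ <= _ * X]distrC [X in _ <= _ * X]ger0_norm ?subr_ge0//.
apply: edge_lipschitz => // s sxy.
by apply: inbox; rewrite min_r ?max_l.
Qed.

End Box.

(** * From continuous partial derivatives to the chain rule *)

Section Differentiability.
Context {R : realType}.

Definition dot_col n (c : 'cV[R]_n) (u : 'rV[R]_n) : R := (u *m c) 0 0.

Lemma dot_col_is_linear n (c : 'cV[R]_n) : linear (dot_col c).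
Proof. by move=> a u v; rewrite /dot_col mulmxDl -scalemxAl !mxE. Qed.

HB.instance Definition _ n (c : 'cV[R]_n) :=
  GRing.isLinear.Build R 'rV[R]_n R _ (dot_col c) (@dot_col_is_linear n c).

Lemma dot_colE n (c : 'cV[R]_n) u : dot_col c u = \sum_i u 0 i * c i 0.
Proof. by rewrite /dot_col mxE. Qed.

Lemma Ck_id (V : normedModType R) k (U : set V) : open U -> Ck_on k U id.
Proof.
move=> oU; have cid x : {for x, continuous (@id V)} by exact: cvg_id.
case: k => [|k]; split=> // v; split=> [x _|]; first exact: derivable_id.
by apply: eq_Ck (Ck_cst k v oU) => // x _; rewrite derive_id.
Qed.

Lemma Ck_coord n k (U : set 'rV[R]_n) i : open U ->
  Ck_on k U (fun x => x 0 i).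
Proof. by move=> oU; apply: (Ck_mxP k id oU).1; exact: Ck_id. Qed.

Lemma Ck_dot_col (V : normedModType R) n k (U : set V) (F : V -> 'rV[R]_n) c :
  open U -> Ck_on k U F -> Ck_on k U (fun x => dot_col c (F x)).
Proof.
move=> oU /(Ck_mxP _ _ oU) CF.
have : Ck_on k U (fun x => \sum_i F x 0 i * c i 0).
  by apply: Ck_sum => // i _; apply: CkM => //; exact: Ck_cst.
by apply: eq_Ck => // x _; rewrite dot_colE.
Qed.

Lemma differentiable_eps (V W : normedModType R) (f : V -> W)
    (df : {linear V -> W}) a : continuous df ->
  (forall e, 0 < e ->
    \forall h \near 0, `|f (h + a) - f a - df h| <= e * `|h|) ->
  differentiable f a.
Proof.
move=> dc dfe; have fE : f \o shift a = cst (f a) + df +o_ 0 id.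
  apply/eqaddoP => e /dfe; apply: filterS => h /=.
  by rewrite fctE /= opprD addrA.
by apply/diff_locallyP; rewrite (diff_unique dc fE).
Qed.

Lemma differentiable_eps_near (V W : normedModType R) (f : V -> W) a e :
  differentiable f a -> 0 < e ->
  \forall h \near 0, `|f (h + a) - f a - 'd f a h| <= e * `|h|.
Proof.
move=> /diff_locallyP[_ /eqaddoP fE] /fE; apply: filterS => h /=.
by rewrite fctE /= opprD addrA.
Qed.

(** Subtracting from f the linear map given by its partial derivatives at a leaves a function whose
    partial derivatives are small near a; [box_lipschitz] turns this into the o(h) estimate. *)
Lemma C1_differentiable n (U : set 'rV[R]_n) (f : 'rV[R]_n -> R) a :
  open U -> Ck_on 1 U f -> U a -> differentiable f a.
Proof.
move=> oU Cf Ua.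
pose c : 'cV[R]_n := \col_i 'D_(delta_mx 0 i) f a.
have dc : continuous (dot_col c : 'rV_n -> R).
  move=> x; apply: (@Ck_continuous _ _ _ 0 setT) => //.
  by apply: Ck_dot_col (Ck_id _ _); exact: openT.
apply: (differentiable_eps dc) => e e0.
(* The denominator absorbs the factor n of [box_lipschitz], and stays nonzero when n = 0. *)
pose e' := e / n.+1%:R; have e'0 : 0 < e' by rewrite divr_gt0.
have near_a : \forall y \near a, U y /\
    forall i, `|'D_(delta_mx 0 i) f a - 'D_(delta_mx 0 i) f y| <= e'.
  apply: filterI; first exact: open_nbhs_nbhs.
  apply: (@filter_forall _ _ (fun i y =>
    `|'D_(delta_mx 0 i) f a - 'D_(delta_mx 0 i) f y| <= e') (nbhs a)) => i.
  have := Ck_continuous (Ck_derive (delta_mx 0 i) Cf) Ua.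
  by move/cvgrPdist_le; exact.
have /nbhs_ballP[r r0 ar] := near_a.
pose g x := f x - dot_col c x.
have inU y : `|y - a| < r -> U y /\
    forall i, `|'D_(delta_mx 0 i) f a - 'D_(delta_mx 0 i) f y| <= e'.
  by move=> ya; apply: ar; rewrite -ball_normE /= distrC.
have Clin : Ck_on 1 U (dot_col c) by apply: (Ck_dot_col c oU); exact: Ck_id.
have dgE y i : `|y - a| < r -> 'D_(delta_mx 0 i) g y =
    'D_(delta_mx 0 i) f y - 'D_(delta_mx 0 i) f a.
  move=> /inU[Uy _]; rewrite deriveB; last first.
  - exact: Ck_derivable Clin Uy.
  - exact: Ck_derivable Cf Uy.
  congr (_ - _); have dl : differentiable (dot_col c) y.
    exact: linear_differentiable.
  by rewrite deriveE// diff_lin//= dot_colE (bigD1 i)//= big1 ?addr0 ?mxE ?eqxx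
    ?mul1r// => j ji; rewrite mxE (negbTE ji) andbF mul0r.
near=> h.
have hr : `|h| < r.
  near: h; apply/nbhs_ballP; exists r => //= h.
  by rewrite -ball_normE/= sub0r normrN.
have := @box_lipschitz R n g a r e' _ _ a (h + a).
rewrite subrr normr0 addrK => /(_ _ _ r0 hr) lip.
have -> : f (h + a) - f a - dot_col c h = g (h + a) - g a.
  by rewrite /g linearD /=; lra.
apply: le_trans (lip _ _) _ => /=.
- by move=> y i /inU[Uy _]; apply: derivableB; [exact: Ck_derivable Cf Uy|
    exact: Ck_derivable Clin Uy].
- by move=> y i yr; rewrite dgE// distrC; have [_] := inU _ yr; exact.
rewrite ler_wpM2r// /e' mulrCA ler_piMr//; first exact: ltW.
by rewrite ler_pdivrMr// mul1r ler_nat.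
Unshelve. all: by end_near. Qed.

Lemma C1_differentiable_row n m (U : set 'rV[R]_n)
    (F : 'rV[R]_n -> 'rV[R]_m) a :
  open U -> Ck_on 1 U F -> U a -> differentiable F a.
Proof.
move=> oU /(Ck_mxP _ _ oU) CF Ua.
have -> : F = \sum_(j < m) (fun x => F x 0 j *: delta_mx 0 j).
  by apply/funext => x; rewrite fct_sumE; exact: row_sum_delta.
apply: differentiable_sum => j; apply: differentiableZl.
exact: (C1_differentiable oU (CF 0 j)).
Qed.

(** The inner map is only assumed derivable in the direction v. Restricted to the line through x
    along v it is a function of one real variable, for which derivable means differentiable, and the
    usual chain rule applies there. *)
Lemma is_derive_comp (V W V' : normedModType R) (f : V -> W) (g : W -> V') x v :
  derivable f x v -> differentiable g (f x) ->
  is_derive x v (g \o f) ('d g (f x) ('D_v f x)).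
Proof.
move=> df dg; have e0 : x = (0 : R) *: v + x by rewrite scale0r add0r.
pose l (t : R) := f (t *: v + x).
have l0 : l 0 = f x by rewrite /l -e0.
have [dl vl] : is_derive (0 : R) 1 l ('D_v f x).
  by rewrite e0; apply: is_derive_line; rewrite -e0.
have {}dl : differentiable l 0 by apply/derivable1_diffP.
have dgl : differentiable (g \o l) 0.
  by apply: differentiable_comp => //; rewrite l0.
have dgf : derivable (g \o f) x v by apply/derivable1P/derivable1_diffP.
split=> //.
have : is_derive (0 : R) 1 (g \o l) ('D_v (g \o f) x).
  by rewrite e0; apply: is_derive_line; rewrite -e0.
move=> [_ <-]; rewrite deriveE// diff_comp//=; last by rewrite l0.
by rewrite l0 -vl deriveE.
Qed.

Lemma derive_partial n (V : normedModType R) (g : 'rV[R]_n -> V) x v :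
  differentiable g x ->
  'd g x v = \sum_i v 0 i *: 'D_(delta_mx 0 i) g x.
Proof.
move=> dg; rewrite [in LHS](row_sum_delta v) linear_sum; apply: eq_bigr => i _.
by rewrite linearZ deriveE.
Qed.

Lemma Ck_comp k (V : normedModType R) n (U : set V) (U' : set 'rV[R]_n)
    (f : V -> 'rV[R]_n) (g : 'rV[R]_n -> R) :
  open U -> open U' -> (forall x, U x -> U' (f x)) ->
  Ck_on k U f -> Ck_on k U' g -> Ck_on k U (g \o f).
Proof.
move=> oU oU' fU; elim: k f g fU => [|k IH] f g fU Cf Cg.
all: split=> [x Ux|//].
1,2: by apply: continuous_comp; [exact: Ck_continuous Cf Ux|
  exact: Ck_continuous Cg (fU _ Ux)].
have C1 : Ck_on 1 U' g by exact: Ck_le Cg.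
have dgf x v : U x -> is_derive x v (g \o f) ('d g (f x) ('D_v f x)).
  move=> Ux; apply: is_derive_comp; first exact: Ck_derivable Cf Ux.
  by apply: C1_differentiable C1 _ => //; exact: fU.
move=> v; split=> [x Ux|]; first by have [] := dgf x v Ux.
have Cs : Ck_on k U (fun x => \sum_i 'D_v f x 0 i *
    ('D_(delta_mx 0 i) g \o f) x).
  apply: Ck_sum => // i _; apply: CkM => //.
    by apply: (Ck_mxP _ _ oU).1; exact: Ck_derive Cf.
  by apply: IH => //; [exact: CkS Cf|exact: Ck_derive Cg].
apply: eq_Ck Cs => // x; rewrite inE => Ux.
have [_ ->] := dgf x v Ux; rewrite derive_partial//.
by apply: C1_differentiable C1 _ => //; exact: fU.
Qed.

End Differentiability.

(** * A flat function *)

Lemma is_derive_eps (R : realType) (V W : normedModType R) (f : V -> W) x v l :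
  (forall e : R, 0 < e ->
    \forall t \near (0 : R), `|f (t *: v + x) - f x - t *: l| <= e * `|t|) ->
  is_derive x v f l.
Proof.
move=> fl.
have fcvg : h^-1 *: ((f \o shift x) (h *: v) - f x) @[h --> 0^'] --> l.
  apply/cvgrPdist_le => e e0; near=> t.
  have t0 : t != 0 by near: t; exact: nbhs_dnbhs_neq.
  have -> : l - t^-1 *: ((f \o shift x) (t *: v) - f x) =
      - (t^-1 *: (f (t *: v + x) - f x - t *: l)).
    by rewrite [in RHS]scalerBr scalerA mulVf// scale1r opprB.
  rewrite normrN normrZ normfV ler_pdivrMl ?normr_gt0// mulrC.
  by near: t; apply: nbhs_dnbhs; exact: fl.
by split; [apply/cvg_ex; exists l|exact: cvg_lim].
Unshelve. all: by end_near. Qed.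

Lemma is_derive_comp_real (R : realType) (V : normedModType R) (f : V -> R)
    (g : R -> R) x v df dg :
  is_derive x v f df -> is_derive (f x) 1 g dg ->
  is_derive x v (g \o f) (df * dg).
Proof.
move=> [dfx <-] [/derivable1_diffP dgx <-].
apply: (is_derive_eq (is_derive_comp dfx dgx)).
by rewrite (deriveE _ dgx) -{1}['D_v f x]mulr1; exact: linearZ.
Qed.

Section Flat.
Context {R : realType}.

(* The powers of 1 / t make the linear span of the family closed under        *)
(* derivation.                                                                *)
Definition flat (j : nat) (t : R) : R :=
  if 0 < t then t^-1 ^+ j * expR (- t^-1) else 0.

(** For n > 0, exp x is the n-th power of exp (x / n), which is at least x / n. *)
Lemma exp_dominates n (x : R) : 0 <= x -> x ^+ n * expR (- x) <= n%:R ^+ n.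
Proof.
move=> x0; case: n => [|n].
  by rewrite !expr0 mul1r -expR0 ler_expR oppr_le0.
rewrite expRN ler_pdivrMr ?expR_gt0//.
have -> : expR x = expR (x / n.+1%:R) ^+ n.+1.
  by rewrite -expRM_natl mulrC divfK ?pnatr_eq0.
rewrite -exprMn lerXn2r ?nnegrE//; first by rewrite mulr_ge0 ?expR_ge0.
rewrite -ler_pdivrMl// mulrC; apply: le_trans (expR_ge1Dx _).
by rewrite lerDr.
Qed.

(** Two further powers of 1 / t are still dominated by the exponential and are paid for by t ^ 2.
    The quadratic bound is what gives derivative 0 at the origin. *)
Lemma flat_le j (t : R) : 0 <= flat j t <= j.+2%:R ^+ j.+2 * t ^+ 2.
Proof.
rewrite /flat; case: ltP => [t0|_].
  2: by rewrite lexx mulr_ge0 ?sqr_ge0 ?exprn_ge0.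
rewrite mulr_ge0 ?expR_ge0 ?exprn_ge0 ?invr_ge0 ?(ltW t0)//=.
have ti : 0 <= t^-1 by rewrite invr_ge0 ltW.
have -> : t^-1 ^+ j * expR (- t^-1) =
    t^-1 ^+ j.+2 * expR (- t^-1) * t ^+ 2.
  rewrite -[in RHS]addn2 exprD mulrAC -(mulrA (t^-1 ^+ j)) -exprMn.
  by rewrite mulVf ?gt_eqF// expr1n mulr1.
by rewrite ler_wpM2r ?sqr_ge0// exp_dominates.
Qed.

Lemma is_derive_flat j (t : R) :
  is_derive t 1 (flat j) (flat j.+2 t - j%:R * flat j.+1 t).
Proof.
have [t0|t0|<-] := ltgtP 0 t.
- pose e (s : R) := s^-1 ^+ j * expR (- s^-1).
  have : is_derive t 1 e (flat j.+2 t - j%:R * flat j.+1 t).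
    have di : is_derive t 1 (fun s : R => s^-1) (- t ^- 2).
      split; first by apply: derivableV; rewrite ?gt_eqF.
      by rewrite deriveV ?gt_eqF// derive_id [_%:A]mulr1.
    have dE : is_derive t 1 (expR \o (fun s : R => - s^-1))
        (t ^- 2 * expR (- t^-1)).
      have := is_derive_comp_real (is_deriveN di) (is_derive_expR (- t^-1)).
      by rewrite opprK.
    have -> : e = (fun s : R => s^-1) ^+ j * (expR \o (fun s : R => - s^-1)).
      by apply/funext => s; rewrite !fctE.
    apply: (is_derive_eq (is_deriveM (is_deriveX j di) dE)).
    rewrite /flat t0 !fctE /= /GRing.scale /= -exprVn.
    by case: (j) => [|i]; rewrite ?exprS ?expr0 /=; lra.
  apply: near_eq_is_derive; near=> s; rewrite /flat /e; case: ltP => // s0.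
  suff : 0 < s by rewrite ltNge s0.
  by near: s; exact: lt_nbhsr.
- have -> : flat j.+2 t - j%:R * flat j.+1 t = 0.
    by rewrite /flat !ltNge (ltW t0)/= mulr0 subr0.
  have : is_derive t 1 (cst 0 : R -> R) 0 by exact: is_derive_cst.
  apply: near_eq_is_derive; near=> s; rewrite /flat ltNge.
  suff /ltW -> : s < 0 by [].
  by near: s; exact: lt_nbhsl.
(* At t = 0 the bound C t ^ 2 of [flat_le] is below e |t| as soon as |t| is at most e / C. *)
rewrite /flat ltxx mulr0 subr0 -/(flat j); apply: is_derive_eps => e e0.
pose C : R := j.+2%:R ^+ j.+2.
have C0 : 0 < C by rewrite exprn_gt0.
near=> s.
rewrite /flat ltxx subr0 scaler0 subr0 addr0 [_%:A]mulr1 -/(flat j s).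
have /andP[f0 fC] := flat_le j s.
rewrite ger0_norm//; apply: (le_trans fC).
rewrite -real_normK ?num_real// expr2 mulrA ler_wpM2r//.
rewrite mulrC -ler_pdivlMr//.
by near: s; exact: (@nbhs0_le R R _ (divr_gt0 e0 C0)).
Unshelve. all: by end_near. Qed.

Lemma Ck_flat (V : normedModType R) k j (U : set V) (f : V -> R) :
  open U -> Ck_on k U f -> Ck_on k U (flat j \o f).
Proof.
move=> oU; elim: k j => [|k IH] j Cf.
all: have df t : differentiable (flat j) t
  by apply/derivable1_diffP; case: (is_derive_flat j t).
all: split=> [x Ux|//].
1,2: by apply: continuous_comp; [exact: Ck_continuous Cf Ux|
  exact: differentiable_continuous].
have dfx x v : U x -> is_derive x v (flat j \o f)
    ('D_v f x * (flat j.+2 (f x) - j%:R * flat j.+1 (f x))).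
  move=> Ux; apply: is_derive_comp_real (is_derive_flat _ _).
  by apply: derivableP; exact: Ck_derivable Cf Ux.
move=> v; split=> [x Ux|]; first by have [] := dfx x v Ux.
have C1 := IH j.+1 (CkS Cf); have C2 := IH j.+2 (CkS Cf).
have C3 := CkM oU (Ck_cst k (j%:R : R) oU) C1.
have := CkM oU (Ck_derive v Cf) (CkB oU C2 C3).
by apply: eq_Ck => // x; rewrite inE => Ux; have [_ ->] := dfx x v Ux.
Qed.

Lemma flat_gt0 (t : R) : (0 < flat 0 t) = (0 < t).
Proof.
by rewrite /flat; case: (ltP 0 t) => _; rewrite ?ltxx// expr0 mul1r expR_gt0.
Qed.

Lemma flat_eq0 j (t : R) : t <= 0 -> flat j t = 0.
Proof. by rewrite /flat leNgt => /negbTE ->. Qed.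

End Flat.

(** * The inverse function theorem *)

Section CkInverse.
Context {R : realType} {V : normedModType R}.
Implicit Types U : set V.

Lemma Ck_det k n U (A : V -> 'M[R]_n) : open U ->
  (forall i j, Ck_on k U (fun x => A x i j)) -> Ck_on k U (fun x => \det (A x)).
Proof.
move=> oU CA; apply: Ck_sum => // s _; apply: CkM => //; first exact: Ck_cst.
exact: Ck_prod.
Qed.

(** By Cramer's formula the entries of the inverse are cofactors divided by a nonvanishing
    determinant. *)
Lemma Ck_invmx k n U (A : V -> 'M[R]_n) : open U ->
  (forall x, U x -> A x \in unitmx) ->
  (forall i j, Ck_on k U (fun x => A x i j)) ->
  forall i j, Ck_on k U (fun x => invmx (A x) i j).
Proof.
move=> oU uA CA i j.
have Cadj : Ck_on k U (fun x => \adj (A x) i j).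
  have : Ck_on k U (fun x => (-1) ^+ (j + i) * \det (row' j (col' i (A x)))).
    apply: CkM => //; first exact: Ck_cst.
    apply: Ck_det => // a b.
    by apply: eq_Ck (CA (lift j a) (lift i b)) => // x _; rewrite !mxE.
  by apply: eq_Ck => // x _; rewrite mxE.
have Cdet : Ck_on k U (fun x => (\det (A x))^-1).
  by apply: CkV => //; [move=> x /uA; rewrite unitmxE unitfE|exact: Ck_det].
apply: eq_Ck (CkM oU Cdet Cadj) => // x; rewrite inE => Ux.
by rewrite /invmx uA// [RHS]mxE.
Qed.

Lemma Ck_mulmx k m n p U (A : V -> 'M[R]_(m, n)) (B : V -> 'M[R]_(n, p)) :
  open U -> Ck_on k U A -> Ck_on k U B -> Ck_on k U (fun x => A x *m B x).
Proof.
move=> oU /(Ck_mxP _ _ oU) CA /(Ck_mxP _ _ oU) CB; apply/(Ck_mxP _ _ oU) => i j.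
have : Ck_on k U (fun x => \sum_l A x i l * B x l j).
  by apply: Ck_sum => // l _; exact: CkM.
by apply: eq_Ck => // x _; rewrite mxE.
Qed.

End CkInverse.

Lemma mulmx_bounded (R : realType) n m (A : 'M[R]_(n, m)) :
  exists2 C, 0 <= C & forall u : 'rV_n, `|u *m A| <= C * `|u|.
Proof.
exists (\sum_i \sum_j `|A i j|).
  by apply: sumr_ge0 => i _; apply: sumr_ge0.
move=> u; apply: row_norm_le.
  by rewrite mulr_ge0//; apply: sumr_ge0 => i _; apply: sumr_ge0.
move=> j; rewrite mxE; apply: (le_trans (ler_norm_sum _ _ _)).
rewrite mulr_suml; apply: ler_sum => i _; rewrite normrM mulrC ler_pM//.
  by rewrite (bigD1 j)//= lerDl sumr_ge0.
exact: row_coord_le.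
Qed.

(** The Jacobian matrix written with directional derivatives, so that the regularity of its entries
    can be read off [Ck_derive]. *)
Definition partials (R : realType) n m (F : 'rV[R]_n -> 'rV[R]_m) x :
  'M[R]_(n, m) :=
  \matrix_(i, j) 'D_(delta_mx 0 i) F x 0 j.

Lemma jacobian_partials (R : realType) n m (F : 'rV[R]_n -> 'rV[R]_m) x :
  differentiable F x -> 'J F x = partials F x.
Proof.
move=> dF; apply/row_matrixP => i; rewrite rowE -deriveEjacobian//.
by apply/rowP => j; rewrite !mxE.
Qed.

Lemma diff_jacobian (R : realType) n m (F : 'rV[R]_n -> 'rV[R]_m) x u :
  'd F x u = u *m 'J F x.
Proof. by rewrite /jacobian mul_rV_lin1. Qed.

(** * Local inverse of a map whose Jacobian at the base point is the identity *)

Section LocalInverse.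
Context {R : realType} {m : nat}.
Variables (U : set 'rV[R]_m) (G : 'rV[R]_m -> 'rV[R]_m) (x0 : 'rV[R]_m).
Hypotheses (oU : open U) (Ux0 : U x0) (sG : smooth_on U G).
Hypothesis JG : 'J G x0 = 1%:M.

Let diffG x : U x -> differentiable G x.
Proof. exact: (C1_differentiable_row oU (sG 1)). Qed.

Let Cpart k i j : Ck_on k U (fun x => partials G x i j).
Proof.
have := (Ck_mxP _ _ oU).1 (Ck_derive (delta_mx 0 i) (sG k.+1)) 0 j.
by apply: eq_Ck => // x _; rewrite mxE.
Qed.

(** The map G - id has zero partial derivatives at x0, hence small ones nearby, and [box_lipschitz]
    makes it 1/2-Lipschitz; the bound 1 / (2 (m + 1)) on the partial derivatives is chosen for this.
    Invertibility persists because the determinant is continuous. *)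
Lemma near_identity : exists2 r, 0 < r & forall x, `|x - x0| < r ->
  [/\ U x, partials G x \in unitmx &
      forall y, `|y - x0| < r -> `|(G y - y) - (G x - x)| <= `|y - x| / 2].
Proof.
have J1 : partials G x0 = 1%:M by rewrite -jacobian_partials//; exact: diffG.
pose e : R := (2 * m.+1%:R)^-1.
have e0 : 0 < e by rewrite invr_gt0 mulr_gt0.
have : \forall y \near x0, (U y /\ \det (partials G y) != 0) /\
    forall ij, `|1%:M ij.1 ij.2 - partials G y ij.1 ij.2| <= e.
  apply: filterI; first apply: filterI; first exact: open_nbhs_nbhs.
    have cdet := Ck_continuous (Ck_det oU (Cpart 0)) Ux0.
    apply: (cdet [set t | t != 0]); apply: open_nbhs_nbhs.
    split; first exact: open_neq.
    by rewrite /= J1 det1 oner_neq0.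
  apply: (@filter_forall _ _ (fun ij y =>
    `|1%:M ij.1 ij.2 - partials G y ij.1 ij.2| <= e) (nbhs x0)) => ij.
  have := Ck_continuous (Cpart 0 ij.1 ij.2) Ux0.
  by move/cvgrPdist_le => /(_ e e0); rewrite J1.
move=> /nbhs_ballP[r r0 near_r]; exists r => // x xr.
have {}near_r y : `|y - x0| < r -> (U y /\ \det (partials G y) != 0) /\
    forall ij, `|1%:M ij.1 ij.2 - partials G y ij.1 ij.2| <= e.
  by move=> yr; apply: near_r; rewrite -ball_normE/= distrC.
have [[Ux dx] _] := near_r x xr.
split=> //; first by rewrite unitmxE unitfE.
move=> y yr; apply: row_norm_le; first by rewrite divr_ge0.
move=> j; pose h z : R := G z 0 j - z 0 j.
have -> : (G y - y - (G x - x)) 0 j = h y - h x by rewrite /h !mxE.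
have dGj z i : U z -> derivable (fun x => G x 0 j) z (delta_mx 0 i).
  by move=> Uz; exact: Ck_derivable ((Ck_mxP 1 _ oU).1 (sG 1) 0 j) Uz.
have dX z i : derivable (fun x : 'rV[R]_m => x 0 j) z (delta_mx 0 i).
  by exact: Ck_derivable (Ck_coord 1 j openT) _.
have dhE z i : U z -> 'D_(delta_mx 0 i) h z = partials G z i j - 1%:M i j.
  move=> Uz; rewrite deriveB//; last exact: dGj.
  congr (_ - _).
    by rewrite mxE derive_mx ?mxE//; exact: Ck_derivable (sG 1) Uz.
  have := derive_mx (@derivable_id R 'rV[R]_m z (delta_mx 0 i)).
  by rewrite derive_id => /rowP/(_ j); rewrite !mxE eqxx /= eq_sym => <-.
apply: (le_trans (@box_lipschitz R m h x0 r e _ _ x y xr yr)).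
- by move=> z i /near_r[[Uz _] _]; apply: derivableB => //; exact: dGj.
- move=> z i /near_r[[Uz _] /(_ (i, j))] /=.
  by rewrite dhE// distrC.
rewrite mulrC ler_wpM2l// /e invfM mulrCA ler_piMr ?invr_ge0//.
by rewrite ler_pdivrMr// mul1r ler_nat.
Qed.

(** Solvability of G x = z comes from minimising the residual over a compact ball, uniqueness and
    continuity from G being close to the identity. The derivative of the inverse is the inverse
    Jacobian composed with the inverse itself, which yields smoothness by bootstrapping. *)
Lemma local_inverse : exists (Z : set 'rV[R]_m) (phi : 'rV[R]_m -> 'rV[R]_m),
  [/\ open Z, smooth_on Z phi, forall z, Z z -> U (phi z) &
      \forall x \near x0, U x /\ Z (G x) /\ phi (G x) = x].
Proof.
have [r r0 near_r] := near_identity.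
pose rho := r / 2; have rho0 : 0 < rho by rewrite divr_gt0.
have rho_r : rho < r by rewrite ltr_pdivrMr// ltr_pMr// ltr1n.
have x0r : `|x0 - x0| < r by rewrite subrr normr0.
(* With this radius the correction x - (G x - z) stays within rho of x0: one half of rho comes from
   z, the other from the 1/2-Lipschitz bound. *)
pose Z := ball (G x0) (rho / 2).
have ZE z : Z z = (`|z - G x0| < rho / 2) by rewrite /Z -ball_normE /= distrC.
have surj z : Z z -> exists x, `|x - x0| <= rho /\ G x = z.
  rewrite ZE => Zz; pose A := closed_ball x0 rho.
  have AE x : A x = (`|x - x0| <= rho).
    by rewrite /A closed_ballE// /closed_ball_ /= distrC.
  have cA : compact A.
    apply: bounded_closed_compact; last exact: closed_ball_closed.
    exists (rho + `|x0|); split=> [|M /ltW rhoM x]; first exact: num_real.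
    rewrite -/(A x) AE => xr /=; apply: le_trans rhoM.
    by rewrite -(subrK x0 x); apply: (le_trans (ler_normD _ _)); rewrite lerD2r.
  have A0 : A !=set0 by exists x0; rewrite AE subrr normr0 ltW.
  have cf : {within A, continuous (fun x => `|G x - z|)}.
    apply: continuous_in_subspaceT => x; rewrite inE AE => xr.
    have [Ux _ _] := near_r x (le_lt_trans xr rho_r).
    apply: (continuous_comp (f := fun x => G x - z)).
    2: exact: norm_continuous.
    apply: continuousB; last exact: cst_continuous.
    exact: Ck_continuous (sG 0) Ux.
  (* A minimiser x of |G x - z| solves G x = z: otherwise x - (G x - z) would *)
  (* have at most half its residual.                                          *)
  have [x] := EVT_min_rV A0 cA cf; rewrite inE AE => xr xmin.
  exists x; split=> //; have xr' := le_lt_trans xr rho_r.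
  have [_ _ /(_ x0 x0r) lip0] := near_r x xr'.
  pose x' := z - (G x - x).
  have x'r : `|x' - x0| <= rho.
    have -> : x' - x0 = (z - G x0) + ((G x0 - x0) - (G x - x)).
      by apply/rowP => i; rewrite /x' !mxE; lra.
    apply: (le_trans (ler_normD _ _)); rewrite [leRHS]splitr.
    apply: lerD; first exact: ltW.
    by apply: (le_trans lip0); rewrite ler_pM2r ?invr_gt0// distrC.
  have [_ _ /(_ x' (le_lt_trans x'r rho_r)) lip] := near_r x xr'.
  have e1 : G x' - x' - (G x - x) = G x' - z.
    by apply/rowP => i; rewrite /x' !mxE; lra.
  have e2 : x' - x = - (G x - z) by apply/rowP => i; rewrite /x' !mxE; lra.
  have := xmin x'; rewrite inE AE => /(_ x'r).
  move: lip; rewrite e1 e2 normrN => lip xm.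
  apply/eqP; rewrite -subr_eq0 -normr_le0; lra.
pose phi z := xget x0 [set x | `|x - x0| <= rho /\ G x = z].
have phiP z : Z z -> `|phi z - x0| <= rho /\ G (phi z) = z.
  by move=> /surj Pz; exact: (xgetPex x0 Pz).
have phir z : Z z -> `|phi z - x0| < r.
  by move=> /phiP[/le_lt_trans pr _]; exact: pr.
have Gphi z : Z z -> G (phi z) = z by move=> /phiP[].
(* G shrinks distances by at most a factor 2. This gives injectivity on the ball and the Lipschitz
   continuity of [phi]. *)
have expand x y : `|x - x0| < r -> `|y - x0| < r ->
    `|y - x| <= 2 * `|G y - G x|.
  move=> xr yr; have [_ _ /(_ y yr) lip] := near_r x xr.
  have : `|y - x| <= `|G y - G x| + `|G y - y - (G x - x)|.
    have -> : y - x = (G y - G x) - (G y - y - (G x - x)).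
      by apply/rowP => i; rewrite !mxE; lra.
    exact: ler_normB.
  lra.
have cphi z : Z z -> {for z, continuous phi}.
  move=> Zz; apply/(@cvgrPdist_le _ _ _ (nbhs z)) => e e0.
  have nZ : \forall w \near z, Z w.
    by apply: open_nbhs_nbhs; split=> //; exact: ball_open.
  have ne : \forall w \near z, `|z - w| <= e / 2.
    have e20 : 0 < e / 2 by rewrite divr_gt0.
    by apply/nbhs_ballP; exists (e / 2) => // w; rewrite -ball_normE => /ltW.
  apply: filterS2 nZ ne => w Zw zw.
  apply: (le_trans (expand _ _ (phir _ Zw) (phir _ Zz))).
  by rewrite !Gphi// mulrC -ler_pdivlMr.
have dphi z v : Z z -> is_derive z v phi (v *m invmx (partials G (phi z))).
  move=> Zz; set J := partials _ _; have [Up uJ _] := near_r _ (phir z Zz).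
  have dG : differentiable G (phi z) by exact: diffG.
  have [C C0 JC] := mulmx_bounded (invmx J).
  apply: is_derive_eps => e e0.
  (* Chosen so that the final bound is exactly e |t|; the added ones keep the denominator
     positive. *)
  pose e1 := e / (2 * (C + 1) * (`|v| + 1)).
  have v0 : 0 < `|v| + 1 by rewrite ltr_wpDl.
  have C10 : 0 < C + 1 by rewrite ltr_wpDl.
  have e10 : 0 < e1 by rewrite divr_gt0// !mulr_gt0.
  have /nbhs_ballP[d /= d0 near_d] := differentiable_eps_near dG e10.
  near=> t.
  have Zt : Z (t *: v + z).
    near: t.
    have cl : {for (0 : R), continuous (fun t : R => t *: v + z)}.
      by apply: continuousD; [exact: scalel_continuous|exact: cst_continuous].
    apply: cl; rewrite scale0r add0r.
    by apply: open_nbhs_nbhs; split=> //; exact: ball_open.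
  set k := phi (t *: v + z) - phi z.
  have kt : `|k| <= 2 * `|t| * `|v|.
    apply: (le_trans (expand _ _ (phir _ Zz) (phir _ Zt))).
    by rewrite !Gphi// addrK normrZ mulrA.
  have kd : `|k| < d.
    apply: (le_lt_trans kt).
    apply: (@le_lt_trans _ _ (`|t| * (2 * (`|v| + 1)))).
      by rewrite mulrAC mulrC ler_wpM2l// ler_wpM2l// lerDl.
    rewrite -ltr_pdivlMr ?mulr_gt0//.
    by near: t; apply: (@nbhs0_lt R R); rewrite divr_gt0 ?mulr_gt0.
  have := near_d k; rewrite -ball_normE /= sub0r normrN => /(_ kd).
  rewrite subrK !Gphi// addrK diff_jacobian jacobian_partials// -/J => tk.
  (* G moves by exactly t v between [phi z] and [phi z + k], so the bracket is, up to sign, the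
     first-order remainder of G. *)
  have -> : k - t *: (v *m invmx J) = (k *m J - t *: v) *m invmx J.
    by rewrite mulmxBl mulmxK// -scalemxAl.
  apply: (le_trans (JC _)); rewrite distrC.
  apply: (@le_trans _ _ ((C + 1) * (e1 * (2 * `|t| * (`|v| + 1))))).
    apply: ler_pM => //; first by rewrite lerDl.
    apply: (le_trans tk); rewrite ler_wpM2l ?(ltW e10)//; apply: (le_trans kt).
    by rewrite ler_wpM2l ?mulr_ge0// lerDl.
  rewrite le_eqVlt; apply/orP; left; apply/eqP; rewrite /e1; field.
  by rewrite !gt_eqF.
exists Z, phi; split.
- exact: ball_open.
- have oZ : open Z by exact: ball_open.
  elim=> [|k IH]; split=> // v.
  split=> [z Zz|]; first by have [] := dphi z v Zz.
  pose B := ball x0 r.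
  have BE x : B x = (`|x - x0| < r) by rewrite /B -ball_normE /= distrC.
  have oB : open B by exact: ball_open.
  have BU : B `<=` U by move=> x; rewrite BE => /near_r[].
  (* The derivative of [phi] along v is this map after [phi]: if [phi] is C^k then so is its
     derivative, hence [phi] is C^(k+1). *)
  have CI : Ck_on k B (fun x => v *m invmx (partials G x)).
    apply: Ck_mulmx => //; first exact: Ck_cst.
    apply/(Ck_mxP _ _ oB); apply: Ck_invmx => // [x|i j].
      by rewrite BE => /near_r[].
    exact: subset_Ck BU (Cpart k i j).
  apply: (eq_Ck (f := (fun x => v *m invmx (partials G x)) \o phi)) => // [z|].
    by rewrite inE => Zz; have [_ ->] := dphi z v Zz.
  apply/(Ck_mxP _ _ oZ) => i j.
  apply: (@Ck_comp _ _ _ _ _ B phi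
    (fun x => (v *m invmx (partials G x)) i j)) => //.
    by move=> x /phir; rewrite BE.
  exact: (Ck_mxP _ _ oB).1.
- by move=> z /phir /near_r[].
near=> x.
have xr : `|x - x0| < r.
  by near: x; apply/nbhs_ballP; exists r => // x; rewrite -ball_normE /= distrC.
have [Ux _ _] := near_r x xr.
have ZG : Z (G x).
  near: x; apply: (Ck_continuous (sG 0) Ux0).
  apply: open_nbhs_nbhs; split; first exact: ball_open.
  by apply: ballxx; rewrite divr_gt0.
split=> //; split=> //; apply/eqP; rewrite -subr_eq0 -normr_le0.
by have := expand _ _ xr (phir _ ZG); rewrite Gphi// subrr normr0 mulr0.
Unshelve. all: by end_near. Qed.

End LocalInverse.

(** * Functions vanishing on an embedded submanifold *)

Section SliceFunction.
Context {R : realType} {m n : nat}.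

(** The i-th factor is positive exactly when the i-th coordinates of y and y0 differ by less than r.
    A product over coordinates fits the sup norm, whose balls are boxes. *)
Definition bump (y0 : 'rV[R]_n) (r : R) (y : 'rV[R]_n) : R :=
  \prod_i (flat 0 (r - (y 0 i - y0 0 i)) * flat 0 (r + (y 0 i - y0 0 i))).

Lemma Ck_bump k U y0 r : open U -> Ck_on k U (bump y0 r).
Proof.
move=> oU; apply: Ck_prod => // i _.
have Cy : Ck_on k U (fun y => y 0 i - y0 0 i).
  by apply: CkB => //; [exact: Ck_coord|exact: Ck_cst].
by apply: CkM => //; apply: (Ck_flat 0 oU (f := fun y => _));
  [apply: CkB|apply: CkD] => //; exact: Ck_cst.
Qed.

Lemma bump_gt0 y0 r : 0 < r -> 0 < bump y0 r y0.
Proof.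
move=> r0; apply: prodr_gt0 => i _.
by rewrite subrr subr0 addr0 mulr_gt0// flat_gt0.
Qed.

Lemma bump_eq0 y0 r y : 0 < r -> r <= `|y - y0| -> bump y0 r y = 0.
Proof.
move=> r0 ry; apply/eqP; apply: contraLR ry => /prodf_neq0 by0; rewrite -ltNge.
apply: row_norm_lt => // i; rewrite !mxE ltr_norml.
have := by0 i isT; rewrite mulf_eq0 negb_or => /andP[].
case: (leP (r - (y 0 i - y0 0 i)) 0) => [/flat_eq0->|h1 _].
  by rewrite eqxx.
case: (leP (r + (y 0 i - y0 0 i)) 0) => [/flat_eq0->|h2 _].
  by rewrite eqxx.
by apply/andP; split; lra.
Qed.

(* k y = <y - g (psi y), lam>, where psi is the local inverse of x |-> g x A  *)
(* applied to y A, so that g \o psi is a retraction onto the image of g.      *)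
Lemma slice_function (S : set 'rV[R]_m) (g : 'rV[R]_m -> 'rV[R]_n) x0
    (A : 'M[R]_(n, m)) (lam : 'cV[R]_n) :
  open S -> S x0 -> smooth_on S g ->
  'J g x0 *m A = 1%:M -> 'J g x0 *m lam = 0 ->
  exists (N : set 'rV[R]_n) (k : 'rV[R]_n -> R),
    [/\ open N, N (g x0), smooth_on N k,
        forall u, 'D_u k (g x0) = dot_col lam u &
        \forall x \near x0, k (g x) = 0].
Proof.
move=> oS Sx0 sg JA Jlam; pose G x := g x *m A.
have dg x : S x -> differentiable g x by exact: C1_differentiable_row (sg 1).
have CA k U : open U -> Ck_on k U (fun y : 'rV[R]_n => y *m A).
  by move=> oU; apply: Ck_mulmx => //; [exact: Ck_id|exact: Ck_cst].
have sG : smooth_on S G.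
  by move=> k; apply: Ck_mulmx => //; exact: Ck_cst.
have JG : 'J G x0 = 1%:M.
  have dG : differentiable G x0 by exact: C1_differentiable_row (sG 1) _.
  have lA : continuous (mulmxr A : 'rV[R]_n -> 'rV[R]_m).
    by move=> y; exact: (Ck_continuous (CA 0 setT openT) I).
  apply/row_matrixP => i; rewrite !rowE -deriveEjacobian// -JA mulmxA.
  have dlA : differentiable (mulmxr A) (g x0) by exact: linear_differentiable.
  have dgi : derivable g x0 (delta_mx 0 i) by apply/diff_derivable/dg.
  have [_] := is_derive_comp dgi dlA.
  by rewrite diff_lin//= (deriveEjacobian _ (dg _ Sx0)) => <-.
have [Z [phi [oZ sphi phiS nphi]]] := local_inverse oS Sx0 sG JG.
have [_ [Zx0 phix0]] := nbhs_singleton nphi.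
pose N := [set y : 'rV[R]_n | Z (y *m A)].
have oN : open N.
  apply: open_comp oZ => y _.
  exact: (Ck_continuous (CA 0 setT openT) I).
pose psi y := phi (y *m A).
have spsi k : Ck_on k N psi.
  apply/(Ck_mxP _ _ oN) => i j.
  apply: (@Ck_comp _ k _ _ _ Z (fun y => y *m A) (fun z => phi z i j)) => //.
    exact: CA.
  exact: (Ck_mxP _ _ oZ).1.
have sgpsi k : Ck_on k N (g \o psi).
  apply/(Ck_mxP _ _ oN) => i j.
  apply: (@Ck_comp _ k _ _ _ S psi (fun x => g x i j)) => //.
    by move=> y /phiS.
  exact: (Ck_mxP _ _ oS).1.
pose F y := y - (g \o psi) y.
have sF k : Ck_on k N F.
  apply: CkD => //; first exact: Ck_id.
  apply/(Ck_mxP _ _ oN) => i j.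
  have : Ck_on k N (fun y => - (g \o psi) y i j).
    by apply: CkN => //; exact: (Ck_mxP _ _ oN).1.
  by apply: eq_Ck => // y _; rewrite mxE.
exists N, (dot_col lam \o F); split=> //.
- by move=> k; exact: Ck_dot_col.
(* The derivative of [g \o psi] takes values in the row space of the Jacobian of g, which [lam]
   annihilates; only the identity part of F contributes. *)
- move=> u; have psi0 : psi (g x0) = x0 by [].
  have dpsi : derivable psi (g x0) u by exact: Ck_derivable (spsi 1) _.
  have isgpsi : is_derive (g x0) u (g \o psi) ('D_u psi (g x0) *m 'J g x0).
    by apply: (is_derive_eq (is_derive_comp dpsi _));
      rewrite psi0 ?diff_jacobian//; exact: dg.
  have dlam y : differentiable (dot_col lam) y.
    apply: linear_differentiable => z.
    exact: (Ck_continuous (Ck_dot_col lam openT (Ck_id 0 openT)) I).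
  have [dF vF] : is_derive (g x0) u F (u - 'D_u psi (g x0) *m 'J g x0).
    exact: (@is_deriveB _ _ _ id (g \o psi) _ _ _ _ (is_derive_id _ _) isgpsi).
  have [_ ->] := is_derive_comp dF (dlam (F (g x0))).
  have cl : continuous (dot_col lam : 'rV[R]_n -> R).
    by move=> y; exact: differentiable_continuous.
  rewrite diff_lin// vF /= linearB/=.
  by rewrite [X in _ - X]/dot_col -mulmxA Jlam mulmx0 mxE subr0.
apply: filterS nphi => x [Sx [_ phix]].
by rewrite /= /F /= /psi -/(G x) phix subrr linear0.
Qed.

End SliceFunction.

(** * Charts as local homeomorphisms *)

Section Charts.
Context {R : realType} {n : nat} {T : topologicalType} (c : chart R n T).

Lemma chart_invK p : chart_dom c p -> chart_inv c (c p) = p.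
Proof. by move=> dp; apply: chart_mapK; rewrite inE. Qed.

Lemma continuous_chart_map p : chart_dom c p -> {for p, continuous c}.
Proof.
have := @chart_map_continuous _ _ _ c.
by rewrite continuous_open_subspace; [move=> cc dp; apply: cc; rewrite inE|
  exact: chart_dom_open].
Qed.

Lemma continuous_chart_inv p :
  chart_dom c p -> {for c p, continuous (chart_inv c)}.
Proof.
have := @chart_inv_continuous _ _ _ c.
rewrite continuous_open_subspace; last exact: chart_codom_open.
by move=> cc dp; apply: cc; rewrite inE; exists p.
Qed.

Lemma chart_image_open (D : set T) :
  open D -> open (c @` (chart_dom c `&` D)).
Proof.
move=> oD; rewrite openE => _ [p [dp Dp] <-]; rewrite /interior.
have nD : nbhs (c p) (chart_inv c @^-1` D).
  apply: (continuous_chart_inv dp); rewrite chart_invK//.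
  exact: open_nbhs_nbhs.
have nO : nbhs (c p) (c @` chart_dom c).
  by apply: open_nbhs_nbhs; split; [exact: chart_codom_open|exists p].
apply: filterS2 nD nO => y Dy [q dq qy]; exists q => //; split=> //.
by move: Dy; rewrite -qy /= chart_invK.
Qed.

Lemma chart_preimage_open (O : set 'rV[R]_n) :
  open O -> open (chart_dom c `&` c @^-1` O).
Proof.
move=> oO; rewrite openE => p [dp Op]; rewrite /interior.
apply: filterI.
  by apply: open_nbhs_nbhs; split=> //; exact: chart_dom_open.
by apply: (continuous_chart_map dp); exact: open_nbhs_nbhs.
Qed.

End Charts.

(** * Differentials on a manifold and extension by zero *)

Section Functions.
Context {R : realType} {n : nat} {W : manifold R n}.

Lemma dfunE (H : W -> R) p u : smooth_fun_on setT H ->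
  dfun H p u = 'D_u (H \o chart_inv (chart_at p)) (chart_at p p).
Proof.
move=> sH; rewrite deriveE//.
apply: (C1_differentiable _ (sH _ (chart_at_atlas p) 1)).
  exact/chart_image_open/openT.
by exists p => //; split=> //; exact: chart_at_dom.
Qed.

Variables (c : chart R n W) (k : 'rV[R]_n -> R).
Variables (N : set 'rV[R]_n) (y0 : 'rV[R]_n) (r : R).
Hypotheses (ac : atlas W c) (r0 : 0 < r) (oN : open N) (sk : smooth_on N k).
Hypothesis ballN : forall y, `|y - y0| <= r -> N y.
Hypothesis Nc : N `<=` c @` chart_dom c.
Hypothesis k0 : forall y, r <= `|y - y0| -> k y = 0.

Let D : set W := chart_dom c `&` c @^-1` N.

Definition extend_by_zero (p : W) : R := if `[< D p >] then k (c p) else 0.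

Lemma extend_by_zeroT p : D p -> extend_by_zero p = k (c p).
Proof. by rewrite /extend_by_zero; case: asboolP. Qed.

Lemma extend_by_zeroF p : ~ D p -> extend_by_zero p = 0.
Proof. by rewrite /extend_by_zero; case: asboolP. Qed.

(* The support of k is compact in the chart, hence closed in the Hausdorff    *)
(* space W.                                                                   *)
Lemma smooth_extend_by_zero : smooth_fun_on setT extend_by_zero.
Proof.
have oD : open D by exact: chart_preimage_open.
pose C : set W := chart_inv c @` closed_ball y0 r.
have CE y : closed_ball y0 r y = (`|y - y0| <= r).
  by rewrite closed_ballE// /closed_ball_ /= distrC.
have cC : compact C.
  apply: continuous_compact.
    apply: continuous_in_subspaceT => y; rewrite inE CE => /ballN/Nc[p dp <-].
    exact: continuous_chart_inv.
  apply: bounded_closed_compact; last exact: closed_ball_closed.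
  exists (r + `|y0|); split=> [|M /ltW rM y]; first exact: num_real.
  rewrite -/(closed_ball y0 r y) CE => yr /=; apply: le_trans rM.
  by rewrite -(subrK y0 y); apply: (le_trans (ler_normD _ _)); rewrite lerD2r.
have clC : closed C by apply: compact_closed cC; exact: manifold_hausdorff.
have K0 q : ~ C q -> extend_by_zero q = 0.
  move=> nCq; have [Dq|/extend_by_zeroF//] := pselect (D q).
  rewrite extend_by_zeroT// k0// leNgt; apply/negP => /ltW cq; apply: nCq.
  by exists (c q); [rewrite CE|apply: chart_invK; case: Dq].
(* D and the complement of C are open and cover W, since C lies in D. On D the function is k after a
   transition map; off C it is zero. *)
move=> c1 ac1 j; apply: Ck_local => _ [q [dq _] <-].
have [Dq|nDq] := pselect (D q).
  pose O := c1 @` (chart_dom c1 `&` D).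
  have oO : open O by exact: chart_image_open.
  exists O; first by exists q.
  have Cc : Ck_on j O (c \o chart_inv c1).
    apply: subset_Ck (atlas_compatible ac1 ac j) => _ [p [dp [dp' _]] <-].
    by exists p.
  apply: eq_Ck (Ck_comp oO oN _ Cc (sk j)) => // [x|_ [p [dp [_ Np]] <-]].
    by rewrite inE => -[p [dp Dp] <-] /=; rewrite chart_invK// extend_by_zeroT.
  by rewrite /= chart_invK.
have nCq : ~ C q.
  case=> y; rewrite CE => /ballN Ny yq; apply: nDq; have [p dp py] := Nc Ny.
  by rewrite -yq -py chart_invK//; split=> //=; rewrite py.
pose O := c1 @` (chart_dom c1 `&` ~` C).
have oO : open O by apply: chart_image_open; exact: closed_openC.
exists O; first by exists q.
apply: eq_Ck (Ck_cst j (0 : R) oO) => // x; rewrite inE => -[p [dp nCp] <-] /=.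
by rewrite chart_invK// K0.
Qed.

End Functions.

(** * Embedded submanifolds and the symplectic complement *)

Section SymplecticEmbeddings.
Context {R : realType} {m n : nat} {M : manifold R m} {W : manifold R n}.

(* A cut-off is needed even when W is a single chart: f(M) need not be closed *)
(* in W.                                                                      *)
Lemma vanishing_function (f : M -> W) p (v : 'rV[R]_n) :
  smooth_embedding f -> ~~ (v <= tangent_map f p)%MS ->
  exists K : W -> R,
    [/\ smooth_fun_on setT K, forall q, K (f q) = 0 & dfun K (f p) v != 0].
Proof.
move=> [[cf sf] _ rf of_] vJ.
pose c := chart_at p; pose c' := chart_at (f p).
have ac : atlas M c by exact: chart_at_atlas.
have ac' : atlas W c' by exact: chart_at_atlas.
have dp : chart_dom c p by exact: chart_at_dom.
have dfp : chart_dom c' (f p) by exact: chart_at_dom.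
pose g := c' \o f \o chart_inv c.
pose S := c @` (chart_dom c `&` f @^-1` chart_dom c').
have oS : open S.
  apply: chart_image_open; apply: open_comp => [q _|]; first exact: cf.
  exact: chart_dom_open.
have sg : smooth_on S g by exact: sf.
have gx0 : g (c p) = c' (f p) by rewrite /g /= chart_invK.
have Sx0 : S (c p) by exists p.
have [A JA] := row_freeP (rf p).
(* The columns of the cokernel matrix are linear forms cutting out the tangent space; v lies outside
   it, so one of them is nonzero on v. *)
have [j vj] : exists j, (v *m cokermx (tangent_map f p)) 0 j != 0.
  apply/existsP; apply: contraNT vJ; rewrite negb_exists => /forallP v0.
  rewrite submxE; apply/eqP/rowP => j; rewrite [RHS]mxE; apply/eqP.
  by have := v0 j; rewrite negbK.
pose lam := col j (cokermx (tangent_map f p)).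
have lamE l (B : 'M_(l, n)) : B *m lam = col j (B *m cokermx (tangent_map f p)).
  by rewrite /lam !colE mulmxA.
have Jlam : tangent_map f p *m lam = 0.
  by rewrite lamE mulmx_coker; apply/colP => i; rewrite !mxE.
have [N0 [k [oN0 N0x0 sk dk nk]]] := slice_function oS Sx0 sg JA Jlam.
have [Q [oQ Qx0] kQ] :
    exists2 Q, open_nbhs (c p) Q & forall x, Q x -> k (g x) = 0.
  by move: nk; rewrite -nbhs_nearE nbhsE => -[Q oQ QT]; exists Q.
(* The topology of M is induced by f, so the part of f(M) inside V comes only from points near p,
   where k is known to vanish. *)
have [V oV fV] :
    exists2 V : set W, open V & f @^-1` V = chart_dom c `&` c @^-1` Q.
  by apply: of_; exact: chart_preimage_open.
have Vfp : V (f p) by have : (f @^-1` V) p by rewrite fV.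
pose N := N0 `&` c' @` (chart_dom c' `&` V).
have oN : open N by apply: openI => //; exact: chart_image_open.
have Ny0 : N (c' (f p)) by split; [rewrite -gx0|exists (f p)].
have /nbhs_ballP[s /= s0 sN] : nbhs (c' (f p)) N by exact: open_nbhs_nbhs.
pose r := s / 2; have r0 : 0 < r by rewrite divr_gt0.
have rs : r < s by rewrite ltr_pdivrMr// ltr_pMr// ltr1n.
pose y0 := c' (f p); pose h y := bump y0 r y * k y.
have Ch i : Ck_on i N h.
  apply: CkM => //; first exact: Ck_bump.
  by apply: subset_Ck (sk i) => y [].
have ballN y : `|y - y0| <= r -> N y.
  by move=> yr; apply: sN; rewrite -ball_normE /= distrC; exact: le_lt_trans rs.
have Nc : N `<=` c' @` chart_dom c' by move=> _ [_ [q [dq _] <-]]; exists q.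
have h0 y : r <= `|y - y0| -> h y = 0 by move=> ry; rewrite /h bump_eq0// mul0r.
pose K := extend_by_zero c' h N.
have sK : smooth_fun_on setT K.
  exact: smooth_extend_by_zero r0 oN Ch ballN Nc h0.
exists K; split=> //.
  move=> q; have [Dq|nDq] := pselect ((chart_dom c' `&` c' @^-1` N) (f q));
    last exact: extend_by_zeroF.
  rewrite /K extend_by_zeroT// /h; case: Dq => dfq [_ [q' [dq' Vq'] q'q]].
  have /= {}q'q : q' = f q by rewrite -(chart_invK dq') q'q chart_invK.
  have : (f @^-1` V) q by rewrite /= -q'q.
  rewrite fV => -[dq Qq].
  by have := kQ _ Qq; rewrite /g /= chart_invK// => ->; rewrite mulr0.
rewrite dfunE// -/c' -/y0.
have ky0 : k y0 = 0 by rewrite /y0 -gx0; exact: kQ.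
have -> : 'D_v (K \o chart_inv c') y0 = 'D_v h y0.
  apply: near_eq_derive; apply: filterS (open_nbhs_nbhs (conj oN Ny0)) => y Ny.
  have [q dq qy] := Nc _ Ny; rewrite /= -qy chart_invK// /K extend_by_zeroT//.
  by split=> //=; rewrite qy.
have db : derivable (bump y0 r) y0 v.
  exact: Ck_derivable (Ck_bump 1 y0 r openT) I.
have dky : derivable k y0 v.
  by apply: Ck_derivable (sk 1) _; rewrite /y0 -gx0.
have dkv : 'D_v k y0 = dot_col lam v by rewrite /y0 -gx0 dk.
(* Since k vanishes at y0, the Leibniz rule leaves the positive value of the bump times [lam]
   evaluated on v. *)
rewrite deriveM// ky0 scale0r addr0 dkv /dot_col lamE mxE.
by rewrite mulf_neq0// gt_eqF// bump_gt0.
Qed.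

(** If the Hamiltonian vector is the image of some u0, then pairing u0 with any u under [wM] equals
    dH on the image of u, which is 0 because H is constant along f. Nondegeneracy of [wM] forces u0
    = 0. *)
Lemma hamiltonian_not_tangent (wM : symplectic_form M) (wW : symplectic_form W)
    (f : symp wM wW) (H : W -> R) (a : R) p :
  smooth_fun_on setT H -> (forall q, H (f q) = a) ->
  (hamiltonian_field wW H (f p) <= tangent_map f p)%MS ->
  hamiltonian_field wW H (f p) = 0.
Proof.
move=> sH Ha /submxP[u0 uJ].
have [[cf sf] _ _ _] := symp_embedding f.
pose c := chart_at p; pose c' := chart_at (f p).
have dp : chart_dom c p by exact: chart_at_dom.
have dfp : chart_dom c' (f p) by exact: chart_at_dom.
pose g := c' \o f \o chart_inv c.
pose S := c @` (chart_dom c `&` f @^-1` chart_dom c').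
have oS : open S.
  apply: chart_image_open; apply: open_comp => [q _|]; first exact: cf.
  exact: chart_dom_open.
have sg : smooth_on S g by apply: sf; exact: chart_at_atlas.
have gx0 : g (c p) = c' (f p) by rewrite /g /= chart_invK.
have Sx0 : S (c p) by exists p.
have Jf : tangent_map f p = 'J g (c p) by [].
(* The chain rule for H after f, which is constant, read in the charts at p and [f p]. *)
have dHJ u : dfun H (f p) (u *m tangent_map f p) = 0.
  pose h := H \o chart_inv c'.
  have dh : differentiable h (g (c p)).
    rewrite gx0; apply: (C1_differentiable _ (sH _ (chart_at_atlas (f p)) 1)).
      exact/chart_image_open/openT.
    by exists (f p).
  have dgu : differentiable g (c p) by exact: (C1_differentiable_row oS (sg 1)).
  have dgu' : derivable g (c p) u by exact: diff_derivable.
  have [_ hgE] := is_derive_comp dgu' dh.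
  rewrite /dfun -/c' -/h -gx0 Jf -deriveEjacobian// -hgE.
  have -> : 'D_u (h \o g) (c p) = 'D_u (cst a) (c p).
    apply: near_eq_derive; apply: filterS (open_nbhs_nbhs (conj oS Sx0)).
    move=> _ [q [dq dfq] <-].
    by rewrite /h /g /= chart_invK// chart_invK// Ha.
  by rewrite derive_cst.
suff u00 : u0 = 0 by rewrite uJ u00 mul0mx.
have wu u : form wM p u0 u = 0.
  by rewrite -(symp_pullback f) -uJ hamiltonian_fieldP dHJ.
have /(congr1 (fun B => B *m invmx (wM p))) : u0 *m wM p = 0.
  apply/rowP => i; have := wu (delta_mx 0 i).
  by rewrite /form trmx_delta -colE !mxE.
by rewrite mulmxK ?form_nondegenerate// mul0mx.
Qed.

End SymplecticEmbeddings.

Lemma form_opp (R : realType) (n : nat) (W : manifold R n)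
    (w : symplectic_form W) p u v : form w p u v = - form w p v u.
Proof.
rewrite /form -[in LHS](trmxK (_ *m _ *m _)) mxE !trmx_mul trmxK form_skew.
by rewrite mulNmx mulmxN mulmxA mxE.
Qed.

Theorem proposition6p1 (R : realType) (m n : nat)
    (M : manifold R m) (W : manifold R n)
    (wM : symplectic_form M) (wW : symplectic_form W) :
  (m < n)%N ->
  fat (@symp_connection R m n M W wM wW) (@curvature R m n M W wM wW).
Proof.
move=> _ f X [H [sH [a Ha] XH]] X0.
have [p Xp] : exists p, X p <> 0.
  by apply: contrapT => nX; apply: X0; apply/funext => p; apply: contrapT => Xp;
    apply: nX; exists p.
have vJ : ~~ (X p <= tangent_map f p)%MS.
  apply/negP; rewrite XH => vJ; apply: Xp; rewrite XH.
  exact: hamiltonian_not_tangent sH Ha vJ.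
have [K [sK Kf dK]] := vanishing_function (symp_embedding f) vJ.
have hX : horizontal_potential f X H by split=> //; exists a.
have hY : horizontal_potential f (hamiltonian_field wW K \o f) K.
  by split=> //; exists 0.
exists (hamiltonian_field wW K \o f); first by exists K.
(* Were the curvature zero, its value at p, which is - dK(X p), would vanish. *)
rewrite (curvatureE hX hY) => /(congr1 (fun F => F p)) /= /eqP.
by rewrite /poisson -XH form_opp oppr_eq0 hamiltonian_fieldP (negbTE dK).
Qed.
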